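(* Let $\lambda=(\lambda_1,\ldots,\lambda_n)$ be a vector of positive integers. If the toric ideal $I_\lambda$ of the rational normal scroll $S(\lambda)$ has a delightful term order, then there exists an integer $m$ such that $\lambda_i\in\{m,m+1,m+2,m+3\}$ for all $i$.
   Context: $\mathbb{K}$ is a field. The rational normal scroll $S(\lambda)$ is the toric variety with parametrization $x_{ij}=s^jt_i$ for $i=1,\ldots,n$, $j=0,\ldots,\lambda_i$; the toric ideal $I_\lambda$ is the kernel of the $\mathbb{K}$-algebra map from the polynomial ring $\mathbb{K}[x_{ij}:1\le i\le n,\,0\le j\le\lambda_i]$ to $\mathbb{K}[s,t_1,\ldots,t_n]$ sending $x_{ij}\mapsto s^jt_i$. Secants: for an ideal $I$ in a polynomial ring $\mathbb{K}[\mathbf{x}]=\mathbb{K}[x_1,\ldots,x_N]$ and $r\ge1$, with new variables $\mathbf{y}_j=(y_{j1},\ldots,y_{jN})$, $j=1,\ldots,r$, and $I(\mathbf{y}_j)$ the image of $I$ under $\mathbf{x}\mapsto\mathbf{y}_j$, set $$I^{\{r\}}=\Bigl(I(\mathbf{y}_1)+\cdots+I(\mathbf{y}_r)+\langle y_{1i}+\cdots+y_{ri}-x_i : 1\le i\le N\rangle\Bigr)\cap\mathbb{K}[\mathbf{x}].$$ A term order $\prec$ is delightful for $I$ if $\mathrm{in}_\prec(I^{\{r\}})=(\mathrm{in}_\prec(I))^{\{r\}}$ for all integers $r\ge2$. *)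

(* Defs.v *)
From mathcomp Require Import all_boot all_order all_algebra.
From mathcomp.multinomials Require Import mpoly.

Set Implicit Arguments.
Unset Strict Implicit.
Unset Printing Implicit Defensive.

Import GRing.Theory.

Local Open Scope ring_scope.

(* Ideals and generating sets are Prop-valued predicates, since membership
   need not be decidable here. *)
Definition ideal_gen (R : comNzRingType) (G : R -> Prop) (f : R) : Prop :=
  exists s : seq (R * R),
    (forall c, c \in s -> G c.2) /\ f = \sum_(c <- s) c.1 * c.2.

Definition term_order (N : nat) (le : rel 'X_{1..N}) : Prop :=
  [/\ [/\ reflexive le, antisymmetric le, transitive le & total le],
      forall m, le 0%MM m
    & forall m m1 m2, le m1 m2 -> le (m1 + m)%MM (m2 + m)%MM].

Definition leading_monomial (K : fieldType) (N : nat) (le : rel 'X_{1..N})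
    (f : {mpoly K[N]}) (m : 'X_{1..N}) : Prop :=
  m \in msupp f /\ forall m', m' \in msupp f -> le m' m.

(* The generators are the monic initial monomials, which over a field generate
   the same ideal as the initial terms; f = 0 contributes none, its support
   being empty. *)
Definition initial_ideal (K : fieldType) (N : nat) (le : rel 'X_{1..N})
    (I : {mpoly K[N]} -> Prop) : {mpoly K[N]} -> Prop :=
  ideal_gen (fun g =>
    exists f m, [/\ I f, leading_monomial le f m & g = 'X_[m]]).

(* K[x, y_1, ..., y_r] is {mpoly K[N + r * N]}: the first N variables are the
   x_i, the remaining r * N are the y_{j,i}. *)
Definition secant_x (K : fieldType) (N r : nat) (i : 'I_N) :
    {mpoly K[N + r * N]} := 'X_(lshift (r * N) i).

Definition secant_y (K : fieldType) (N r : nat) (j : 'I_r) (i : 'I_N) :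
    {mpoly K[N + r * N]} := 'X_(rshift N (mxvec_index j i)).

Definition secant_gens (K : fieldType) (N r : nat)
    (I : {mpoly K[N]} -> Prop) (g : {mpoly K[N + r * N]}) : Prop :=
  (exists (j : 'I_r) f, I f /\ g = f \mPo [tuple secant_y K j i | i < N])
  \/ (exists i : 'I_N, g = (\sum_(j < r) secant_y K j i) - secant_x K r i).

Definition secant_ideal (K : fieldType) (N r : nat)
    (I : {mpoly K[N]} -> Prop) (f : {mpoly K[N]}) : Prop :=
  ideal_gen (@secant_gens K N r I) (f \mPo [tuple secant_x K r i | i < N]).

Definition delightful (K : fieldType) (N : nat) (I : {mpoly K[N]} -> Prop)
    (le : rel 'X_{1..N}) : Prop :=
  forall r : nat, (2 <= r)%N ->
    forall f : {mpoly K[N]},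
      initial_ideal le (secant_ideal r I) f
      <-> secant_ideal r (initial_ideal le I) f.

(* The variable x_{ij}, with 0 <= j <= lam i, is indexed by the dependent pair
   (i, j); enum_val turns a position in {mpoly K[scroll_dim lam]} into such a
   pair. *)
Definition scroll_index (n : nat) (lam : 'I_n -> nat) : finType :=
  {i : 'I_n & 'I_(lam i).+1}.

Definition scroll_dim (n : nat) (lam : 'I_n -> nat) : nat :=
  #|scroll_index lam|.

(* In the target K[s, t_1, ..., t_n] = {mpoly K[n.+1]}, s is the variable of
   index 0 and t_i the variable of index lift ord0 i. *)
Definition scroll_image (K : fieldType) (n : nat) (lam : 'I_n -> nat)
    (p : scroll_index lam) : {mpoly K[n.+1]} :=
  'X_ord0 ^+ (tagged p) * 'X_(lift ord0 (tag p)).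

Definition scroll_ideal (K : fieldType) (n : nat) (lam : 'I_n -> nat)
    (f : {mpoly K[scroll_dim lam]}) : Prop :=
  f \mPo [tuple scroll_image K (enum_val k) | k < scroll_dim lam] = 0.

(* Main.v *)
Require Import Defs.
From mathcomp Require Import all_boot all_order all_algebra.
From mathcomp.multinomials Require Import mpoly.
From mathcomp Require Import zify ring.

(* Call a pair of variables standard if its product is the least monomial of its
   toric degree; products of nonstandard pairs lie in the initial ideal of the
   scroll, and a product of r + 1 variables that are pairwise nonstandard lies
   in the r-th secant of that initial ideal. Under a delightful order such a
   product is therefore the leading monomial of an element of the secant ideal.

   For r = lam_i + 1 the secant ideal contains no nonzero polynomial in the
   variables of block i, so every square is standard. Hence the order is convex
   along each block, and the standard pairs joining two blocks x_0, ..., x_a and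
   y_0, ..., y_b form a monotone lattice path from (0, 0) to (a, b).

   For r = 2 the relevant constraints are in degree three: if gamma is a weight
   on the variables such that the sum of the weights vanishes on every cubic
   monomial of a fixed toric degree that contains a standard pair, then it
   vanishes on every monomial of that degree. Suitable weights exclude that the
   path stays at x_i for two steps when 0 < i < a, or for three steps when i is
   0 or a; hence b <= (a - 1) + 2 + 2. *)

Set Implicit Arguments.
Unset Strict Implicit.
Unset Printing Implicit Defensive.

Import GRing.Theory.
Local Open Scope ring_scope.

(** * Ideals, evaluations and secants *)

Section IdealGen.
Context (R : comNzRingType) (G : R -> Prop).

Lemma ideal_gen_mem g : G g -> ideal_gen G g.
Proof.
move=> Gg; exists [:: (1, g)]; split; last by rewrite big_seq1 mul1r.
by move=> c; rewrite inE => /eqP ->.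
Qed.

Lemma ideal_gen0 : ideal_gen G 0.
Proof. by exists [::]; split; rewrite ?big_nil. Qed.

Lemma ideal_genD f g : ideal_gen G f -> ideal_gen G g -> ideal_gen G (f + g).
Proof.
move=> [s [Gs ->]] [t [Gt ->]]; exists (s ++ t); rewrite big_cat; split=> // c.
by rewrite mem_cat => /orP [/Gs | /Gt].
Qed.

Lemma ideal_genMl a f : ideal_gen G f -> ideal_gen G (a * f).
Proof.
move=> [s [Gs ->]]; exists [seq (a * c.1, c.2) | c <- s]; split.
  by move=> _ /mapP [c /Gs Gc ->].
by rewrite big_map mulr_sumr; apply: eq_bigr => c _; rewrite mulrA.
Qed.

Lemma ideal_genMr a f : ideal_gen G f -> ideal_gen G (f * a).
Proof. by rewrite mulrC; apply: ideal_genMl. Qed.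

Lemma ideal_gen_sum (I : Type) (s : seq I) (P : pred I) (F : I -> R) :
  (forall i, P i -> ideal_gen G (F i)) -> ideal_gen G (\sum_(i <- s | P i) F i).
Proof.
by move=> GF; apply: big_ind => //; [exact: ideal_gen0 | exact: ideal_genD].
Qed.

Lemma ideal_gen_prod_sub (I : Type) (s : seq I) (a b : I -> R) :
  (forall i, ideal_gen G (a i - b i)) ->
  ideal_gen G (\prod_(i <- s) a i - \prod_(i <- s) b i).
Proof.
move=> Gab; elim: s => [|i s IHs]; first by rewrite !big_nil subrr; apply: ideal_gen0.
rewrite !big_cons.
set A := \prod_(j <- s) a j in IHs *; set B := \prod_(j <- s) b j in IHs *.
have -> : a i * A - b i * B = (a i - b i) * A + b i * (A - B) by ring.
by apply: ideal_genD; [apply: ideal_genMr | apply: ideal_genMl].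
Qed.

Lemma ideal_gen_rmorph0 (S : comNzRingType) (h : {rmorphism R -> S}) f :
  (forall g, G g -> h g = 0) -> ideal_gen G f -> h f = 0.
Proof.
move=> hG [s [Gs ->]]; rewrite rmorph_sum big_seq big1 // => c cs.
by rewrite rmorphM (hG c.2) ?mulr0 //; apply: Gs.
Qed.

End IdealGen.

Lemma mmap_comp_mpoly (R S : comNzRingType) (h : {rmorphism R -> S})
    (N M : nat) (v : 'I_M -> S) (t : N.-tuple {mpoly R[M]}) (f : {mpoly R[N]}) :
  mmap h v (f \mPo t) = mmap h (fun i => mmap h v (tnth t i)) f.
Proof.
rewrite comp_mpolyE raddf_sum /= [RHS]/mmap; apply: eq_bigr => m _.
rewrite mmapZ rmorph_prod /mmap1; congr (_ * _).
by apply: eq_bigr => i _; rewrite rmorphXn.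
Qed.

Lemma eq_mmap (R S : comNzRingType) (h : R -> S) (N : nat) (v w : 'I_N -> S) f :
  v =1 w -> mmap h v f = mmap h w f.
Proof. by move=> vw; apply: eq_bigr => m _; congr (_ * _); apply: mmap1_eq. Qed.

(** The substitution y_j = P_j, x = P_1 + ... + P_r kills every secant generator. Coordinates in an
    arbitrary [S] make generic points available over any field. *)
Lemma secant_eval0 (K : fieldType) (S : comNzRingType) (h : {rmorphism K -> S})
    (N r : nat) (I : {mpoly K[N]} -> Prop) (P : 'I_r -> 'I_N -> S) f :
  (forall j g, I g -> mmap h (P j) g = 0) ->
  secant_ideal r I f -> mmap h (fun i => \sum_(j < r) P j i) f = 0.
Proof.
move=> IP If; pose v : 'I_(N + r * N) -> S :=
  row_mx (\row_i \sum_(j < r) P j i) (mxvec (\matrix_(j < r, i < N) P j i)) 0.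
have vx i : v (lshift (r * N) i) = \sum_(j < r) P j i.
  by rewrite /v row_mxEl mxE.
have vy j i : v (rshift N (mxvec_index j i)) = P j i.
  by rewrite /v row_mxEr mxvecE mxE.
have hx i : mmap h v (secant_x K r i) = \sum_(j < r) P j i.
  by rewrite /secant_x mmapX mmap1U vx.
have hy j i : mmap h v (secant_y K j i) = P j i.
  by rewrite /secant_y mmapX mmap1U vy.
have <- : mmap h v (f \mPo [tuple secant_x K r i | i < N])
          = mmap h (fun i => \sum_(j < r) P j i) f.
  by rewrite mmap_comp_mpoly; apply: eq_mmap => i; rewrite tnth_mktuple hx.
apply: (ideal_gen_rmorph0 (h := mmap h v) _ If) => g [[j [f0 [If0 ->]]] | [i ->]].
  rewrite /= mmap_comp_mpoly -[RHS](IP j f0 If0); apply: eq_mmap => i.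
  by rewrite tnth_mktuple hy.
rewrite rmorphB rmorph_sum /= hx; apply/eqP; rewrite subr_eq0; apply/eqP.
by apply: eq_bigr => j _; rewrite hy.
Qed.

Lemma secant_idealMl (K : fieldType) (N r : nat) (I : {mpoly K[N]} -> Prop) a f :
  secant_ideal r I f -> secant_ideal r I (a * f).
Proof. by move=> If; rewrite /secant_ideal rmorphM; apply: ideal_genMl. Qed.

(* Pigeonhole: modulo the secant generators the product expands into monomials
   sending the r + 1 factors to r groups of variables. *)
Lemma secant_ideal_prod (K : fieldType) (N r : nat) (M : {mpoly K[N]} -> Prop)
    (u : 'I_r.+1 -> 'I_N) :
  (forall s t, s != t -> M ('X_(u s) * 'X_(u t))) ->
  secant_ideal r M (\prod_(t < r.+1) 'X_(u t)).
Proof.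
move=> Mu; rewrite /secant_ideal rmorph_prod.
set J := ideal_gen _.
have Jxy t : J ('X_(u t) \mPo [tuple secant_x K r i | i < N]
                 - \sum_(j < r) secant_y K j (u t)).
  rewrite comp_mpolyXU -tnth_nth tnth_mktuple -opprB -mulN1r.
  by apply: ideal_genMl; apply: ideal_gen_mem; right; exists (u t).
have Jprod := ideal_gen_prod_sub (index_enum 'I_r.+1) Jxy.
rewrite -[X in J X](subrK (\prod_(t < r.+1) \sum_(j < r) secant_y K j (u t))).
apply: ideal_genD => //; rewrite bigA_distr_bigA /=.
apply: ideal_gen_sum => f _.
have /injectivePn [s [t st fst]] : ~~ injectiveb f.
  by apply/negP => /injectiveP /leq_card; rewrite !card_ord ltnn.
rewrite (bigD1 s) //= (bigD1 t) 1?eq_sym //= mulrA fst.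
apply: ideal_genMr; apply: ideal_gen_mem; left; exists (f t), ('X_(u s) * 'X_(u t)).
by split; [apply: Mu | rewrite rmorphM /= !comp_mpolyXU -!tnth_nth !tnth_mktuple].
Qed.

(** * Secants of the scroll *)

(** Modulo the square of the variable, multiplying polynomials with constant term 1 adds their
    linear coefficients. *)
Lemma coef0_prod_exp (C : comNzRingType) (I : finType) (c : I -> {poly C})
    (m : I -> nat) :
  (forall i, (c i)`_0 = 1) ->
  (\prod_i c i ^+ m i)`_0 = 1 /\
  (\prod_i c i ^+ m i)`_1 = \sum_i (c i)`_1 *+ m i.
Proof.
move=> c1.
have coef1M (p q : {poly C}) : p`_0 = 1 -> q`_0 = 1 ->
    (p * q)`_0 = 1 /\ (p * q)`_1 = p`_1 + q`_1.
  move=> p1 q1; rewrite coef0M p1 q1 mulr1; split=> //.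
  by rewrite coefM !big_ord_recl big_ord0 /= p1 q1 mul1r mulr1 addr0 addrC.
have coef1X i k : (c i ^+ k)`_0 = 1 /\ (c i ^+ k)`_1 = (c i)`_1 *+ k.
  elim: k => [|k [IH0 IH1]]; first by rewrite expr0 mulr0n !coef1.
  rewrite exprS; have [-> ->] := coef1M _ _ (c1 i) IH0.
  by rewrite IH1 mulrS.
apply: (big_rec2 (fun (p : {poly C}) s => p`_0 = 1 /\ p`_1 = s)).
  by rewrite !coef1.
move=> i s p _ [p0 <-]; have [ci0 ci1] := coef1X i (m i).
by rewrite -ci1; apply: coef1M.
Qed.

Lemma coef01_1DCX (C : nzRingType) (a : C) :
  (1 + a%:P * 'X)`_0 = 1 /\ (1 + a%:P * 'X)`_1 = a.
Proof. by rewrite !coefD !coefMX !coef1 coefC addr0 add0r. Qed.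

(** With ['X] as eps, the second point scales t by eps and leaves s alone, hence the factor 1. Each
    coordinate is linear in t and so receives eps exactly once. *)
Lemma perturbed_mnm (M : nat) (C : comNzRingType) (X Y : {mpoly {poly C}[M]})
    (x y : C) (k : nat) :
  X ^+ k * Y + (X * (x%:P * 1)%:MP) ^+ k * (Y * (y%:P * 'X)%:MP)
  = (1 + (x ^+ k * y)%:P * 'X)%:MP * (X ^+ k * Y).
Proof.
rewrite mulr1 exprMn mulrACA -(rmorphXn (@mpolyC M {poly C})) -mpolyCM mulrA -polyC_exp -polyCM.
by rewrite mpolyCD mpolyC1 mulrDl mul1r [_%:MP * _]mulrC.
Qed.

Section Scroll.
Context (K : fieldType) (n : nat) (lam : 'I_n -> nat).
Local Notation N := (scroll_dim lam).
Local Notation scroll := (@scroll_ideal K n lam).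

Definition scroll_mnm (k : 'I_N) : 'X_{1..n.+1} :=
  (U_(ord0) *+ tagged (enum_val k) + U_(lift ord0 (tag (enum_val k))))%MM.

Lemma scroll_mnm0 k : scroll_mnm k ord0 = tagged (enum_val k).
Proof. by rewrite mnmDE mulmnE !mnm1E eqxx mul1n addn0. Qed.

Lemma scroll_mnm_lift k i : scroll_mnm k (lift ord0 i) = (tag (enum_val k) == i).
Proof. by rewrite mnmDE mulmnE !mnm1E (inj_eq (@lift_inj _ ord0)). Qed.

Lemma scroll_mnm_inj : injective scroll_mnm.
Proof.
move=> k l /mnmP kl; apply: enum_val_inj.
have := kl ord0; have := kl (lift ord0 (tag (enum_val k))).
rewrite !scroll_mnm0 !scroll_mnm_lift eqxx.
case: (enum_val k) (enum_val l) => [i p] [j q] /=.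
case: eqP => // ji _; case: _ / ji p => p pq.
by congr existT; apply: val_inj.
Qed.

Lemma mpolyX_scroll_mnm (R : nzRingType) (k : 'I_N) :
  'X_[R, scroll_mnm k]
  = 'X_ord0 ^+ tagged (enum_val k) * 'X_(lift ord0 (tag (enum_val k))).
Proof. by rewrite mpolyXD mpolyXn. Qed.

(** The toric degree: the exponent of the image of a monomial under the parametrization. *)
Definition scroll_degree (m : 'X_{1..N}) : 'X_{1..n.+1} :=
  (\sum_(k < N) scroll_mnm k *+ m k)%MM.

Lemma scroll_degreeD m1 m2 :
  scroll_degree (m1 + m2) = (scroll_degree m1 + scroll_degree m2)%MM.
Proof.
apply/mnmP => i; rewrite mnmDE !mnm_sumE -big_split; apply: eq_bigr => k _ /=.
by rewrite !mulmnE mnmDE mulnDr.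
Qed.

Lemma scroll_degree1 k : scroll_degree U_(k) = scroll_mnm k.
Proof.
apply/mnmP => i; rewrite mnm_sumE (bigD1 k) //= big1 => [|l /negbTE lk].
  by rewrite addn0 mulmnE mnm1E eqxx muln1.
by rewrite mulmnE mnm1E eq_sym lk muln0.
Qed.

Lemma secant_scroll_eval0 (S : comNzRingType) (h : {rmorphism K -> S}) (r : nat)
    (v : 'I_r -> 'I_n.+1 -> S) f :
  secant_ideal r scroll f ->
  mmap h (fun k : 'I_N => \sum_(j < r) v j ord0 ^+ tagged (enum_val k)
                                * v j (lift ord0 (tag (enum_val k)))) f = 0.
Proof.
apply: secant_eval0 => j g Ig; rewrite -[RHS](mmap0 (v j) h) -Ig.
rewrite mmap_comp_mpoly; apply: eq_mmap => k.
by rewrite tnth_mktuple rmorphM rmorphXn /= !mmapX !mmap1U.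
Qed.

(* The first secant point is [q] and the second [eps p q], taken coordinatewise
   with generic [p] and [q]; the sum has coordinates [q^u (1 + eps p^u)], and
   the coefficient of [eps] is read off. *)
Lemma secant2_scroll_coef f (D : 'X_{1..n.+1}) (z : 'I_N) :
  secant_ideal 2 scroll f ->
  \sum_(m <- msupp f | scroll_degree m == D) f@_m *+ m z = 0.
Proof.
move=> If.
(* [C] contains the coordinates of p, [B] adjoins eps, and the outer variables over [B] are the
   coordinates of q. *)
pose C := {mpoly K[n.+1]}; pose B := {poly C}.
pose h : {rmorphism K -> {mpoly B[n.+1]}} :=
  @mpolyC n.+1 B \o (@polyC C \o @mpolyC n.+1 K).
pose v (j : 'I_2) (i : 'I_n.+1) : {mpoly B[n.+1]} :=
  if j == 0 then 'X_i
  else 'X_i * (('X_i : C)%:P * (if i == ord0 then 1 else 'X))%:MP.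
pose c (k : 'I_N) : B := 1 + ('X_[scroll_mnm k] : C)%:P * 'X.
have := secant_scroll_eval0 h v If.
rewrite (@eq_mmap _ _ h _ _ (fun k => (c k)%:MP * 'X_[scroll_mnm k])); last first.
  move=> k; rewrite big_ord_recl big_ord1 /v /= /c !mpolyX_scroll_mnm.
  exact: perturbed_mnm.
(* Extract in turn the coefficients of q^D, of eps, and of the p-monomial of [z]; since [scroll_mnm]
   is injective, the last isolates the factor [m z]. *)
move/(congr1 (mcoeff D)); rewrite mcoeff0 /mmap raddf_sum /=.
move/(congr1 (fun p : B => p`_1)); rewrite coef0 coef_sum.
move/(congr1 (mcoeff (scroll_mnm z))); rewrite mcoeff0 raddf_sum /= => E0.
rewrite big_mkcond -[RHS]E0; apply: eq_bigr => m _.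
have -> : mmap1 (fun k => (c k)%:MP * 'X_[scroll_mnm k]) m
          = (\prod_k c k ^+ m k)%:MP * 'X_[scroll_degree m].
  rewrite /mmap1 rmorph_prod /scroll_degree.
  rewrite (big_morph _ (@mpolyXD n.+1 B) (@mpolyX0 n.+1 B)) -big_split.
  apply: eq_bigr => k _ /=.
  by rewrite exprMn (rmorphXn (@mpolyC n.+1 B)) mpolyXn.
rewrite mulrA -mpolyCM mcoeffCM mcoeffX.
case: eqP => _; last by rewrite mulr0 coef0 mcoeff0.
have c01 k := coef01_1DCX ('X_[scroll_mnm k] : C).
rewrite mulr1 coefCM (coef0_prod_exp m (fun k => (c01 k).1)).2 mcoeffCM.
rewrite raddf_sum /= (bigD1 z) //= big1 => [|k /negbTE kz].
  by rewrite addr0 (c01 z).2 mcoeffMn mcoeffX eqxx mulr_natr.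
by rewrite (c01 k).2 mcoeffMn mcoeffX (inj_eq scroll_mnm_inj) kz mul0rn.
Qed.
End Scroll.

Lemma mmap_axis (K : fieldType) (S : comNzRingType) (h : {rmorphism K -> S})
    (N : nat) (u0 : 'I_N) (d : S) (f : {mpoly K[N]}) :
  mmap h (fun u => if u == u0 then d else 0) f
  = \sum_(m <- msupp f | m == (U_(u0) *+ m u0)%MM) h f@_m * d ^+ m u0.
Proof.
rewrite big_mkcond; apply: eq_bigr => m _; case: eqP => [em | nem]; last first.
  have [u uu0 mu] : exists2 u, u != u0 & m u != 0%N.
    apply/exists_inP; apply/contra_notT: nem; rewrite negb_exists => /forallP mz.
    apply/mnmP => u; rewrite mulmnE mnm1E eq_sym.
    have := mz u; case: eqP => [-> | _] /=; first by rewrite mul1n.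
    by rewrite negbK => /eqP.
  rewrite /mmap1 (bigD1 u) //= ifN //.
  by rewrite expr0n (negbTE mu) mul0r mulr0.
rewrite /mmap1 (bigD1 u0) //= eqxx big1 ?mulr1 // => u uu0.
have -> : m u = 0%N by rewrite em mulmnE mnm1E eq_sym (negbTE uu0).
by rewrite expr0.
Qed.

(* [lam i + 1] points of the rational normal curve in block [i] can be combined
   (columns of the adjugate of a Vandermonde matrix) into any coordinate vector. *)
Lemma secant_scroll_power (K : fieldType) (n : nat) (lam : 'I_n -> nat)
    (u0 : 'I_(scroll_dim lam)) (c : nat) f :
  secant_ideal (lam (tag (enum_val u0))).+1 (@scroll_ideal K n lam) f ->
  f@_(U_(u0) *+ c) = 0.
Proof.
set i := tag _; set b := lam i => If.
pose k : 'I_b.+1 := tagged (enum_val u0).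
(* The nodes ['X^j] are distinct in [{poly K}] even over a finite field. *)
pose V := Vandermonde b.+1 (\row_(j < b.+1) ('X^j : {poly K})).
pose h : {rmorphism K -> {poly {poly K}}} := polyC \o polyC.
(* The points sum to [\det V] times the outer variable at [u0] and to 0 elsewhere. The outer
   variable records the exponent, so its power [c] isolates one coefficient of [f]. *)
pose v (j : 'I_b.+1) (i' : 'I_n.+1) : {poly {poly K}} :=
  if i' == ord0 then ('X^j)%:P
  else if i' == lift ord0 i then (\adj V j k)%:P * 'X else 0.
have detV : \det V != 0.
  rewrite det_Vandermonde; apply/prodf_neq0 => j _; apply/prodf_neq0 => l jl.
  rewrite !mxE subr_eq0; apply/eqP => /(congr1 (fun p : {poly K} => size p)).
  by rewrite !size_polyXn => -[lj]; rewrite lj ltnn in jl.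
have sumV (p : 'I_b.+1) : \sum_(j < b.+1) ('X^j) ^+ p * \adj V j k = \det V *+ (p == k).
  have := congr1 (fun M : 'M__ => M p k) (mul_mx_adj V); rewrite !mxE => <-.
  by apply: eq_bigr => j _; rewrite !mxE.
have := secant_scroll_eval0 h v If.
rewrite (@eq_mmap _ _ h _ _ (fun u => if u == u0 then (\det V)%:P * 'X else 0)).
  rewrite mmap_axis => /(congr1 (fun p : {poly {poly K}} => p`_c)).
  rewrite coef0 coef_sum; set m0 := (U_(u0) *+ c)%MM.
  have m0u : m0 u0 = c by rewrite mulmnE mnm1E eqxx mul1n.
  have hE a k' : (h a * ((\det V)%:P * 'X) ^+ k')`_c
                 = a%:P * \det V ^+ k' *+ (c == k').
    rewrite exprMn -polyC_exp mulrA -polyCM coefCM coefXn; case: (c == k').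
      by rewrite mulr1.
    by rewrite mulr0.
  move=> sum0; apply/eqP; rewrite mcoeff_eq0; apply/negP => m0f; move: sum0.
  rewrite big_mkcond (bigD1_seq m0) ?msupp_uniq //= m0u eqxx hE eqxx big1.
    move/eqP; rewrite addr0 mulf_eq0 expf_eq0 (negbTE detV) andbF orbF polyC_eq0.
    by rewrite mcoeff_eq0 m0f.
  move=> m mm0; case: eqP => // em; rewrite hE; case: eqP => // cm.
  by rewrite em -cm eqxx in mm0.
move=> u; rewrite /v eqxx.
have uu0E : (u == u0) = (enum_val u == enum_val u0) by rewrite (inj_eq enum_val_inj).
rewrite uu0E; case: (enum_val u) => [i' p] /=.
have -> : enum_val u0 = Tagged (fun i => 'I_(lam i).+1) k.
  have eta (s : scroll_index lam) :
      s = Tagged (fun i => 'I_(lam i).+1) (tagged s) by case: s.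
  exact: eta.
rewrite (inj_eq (@lift_inj _ ord0)).
case: (eqVneq i' i) p => [-> p | ii' p]; last first.
  rewrite big1 => [|j _]; last by rewrite mulr0.
  by case: eqP => // /(congr1 tag) /= ii; rewrite ii eqxx in ii'.
rewrite eq_Tagged /=.
under eq_bigr do rewrite mulrA -polyC_exp -polyCM.
rewrite -mulr_suml -rmorph_sum /= sumV.
by case: eqP => _; rewrite ?mul0r.
Qed.

(** * Delightful orders *)

Section TermOrder.
Context (N : nat) (le : rel 'X_{1..N}) (ord : term_order le).

Lemma term_order_refl : reflexive le.
Proof. by case: ord => -[]. Qed.

Lemma term_order_anti m1 m2 : le m1 m2 -> le m2 m1 -> m1 = m2.
Proof. by case: ord => -[_ anti _ _] _ _ l12 l21; apply: anti; rewrite l12. Qed.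

Lemma term_order_trans : transitive le.
Proof. by case: ord => -[]. Qed.

Lemma term_order_total : total le.
Proof. by case: ord => -[]. Qed.

Lemma term_orderD2r m m1 m2 : le (m1 + m)%MM (m2 + m)%MM = le m1 m2.
Proof.
case: ord => _ _ leD; apply/idP/idP => [l12|]; last exact: leD.
case/orP: (term_order_total m1 m2) => // /(leD m) l21.
have /addIm -> := term_order_anti l12 l21; exact: term_order_refl.
Qed.

Lemma term_orderD m1 m2 p1 p2 :
  le m1 p1 -> le m2 p2 -> le (m1 + m2)%MM (p1 + p2)%MM.
Proof.
move=> l1 l2; apply: (@term_order_trans (p1 + m2)%MM).
  by rewrite term_orderD2r.
by rewrite ![(p1 + _)%MM]addmC term_orderD2r.
Qed.

Lemma term_orderD_eq m1 m2 p1 p2 :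
  le m1 p1 -> le m2 p2 -> le (p1 + p2)%MM (m1 + m2)%MM -> m1 = p1.
Proof.
move=> l1 l2 l; apply: term_order_anti => //.
rewrite -(term_orderD2r m2); apply: term_order_trans l.
by rewrite ![(p1 + _)%MM]addmC term_orderD2r.
Qed.

End TermOrder.

(** * Standard pairs and the constraints they satisfy *)

Section Delightful.
Context (K : fieldType) (n : nat) (lam : 'I_n -> nat).
Local Notation N := (scroll_dim lam).
Local Notation scroll := (@scroll_ideal K n lam).
Context (le : rel 'X_{1..N}) (ord : term_order le) (dlt : delightful scroll le).

(** Competitors that are products of two variables suffice: the toric degree determines the number
    of factors. *)
Definition std_pair (u v : 'I_N) : bool :=
  [forall u', forall v',
    ((scroll_mnm u' + scroll_mnm v')%MM == (scroll_mnm u + scroll_mnm v)%MM)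
    ==> le (U_(u) + U_(v))%MM (U_(u') + U_(v'))%MM].

Lemma std_pairP u v :
  reflect (forall u' v',
      (scroll_mnm u' + scroll_mnm v')%MM = (scroll_mnm u + scroll_mnm v)%MM ->
      le (U_(u) + U_(v))%MM (U_(u') + U_(v'))%MM)
    (std_pair u v).
Proof.
apply: (iffP forallP) => [std u' v' /eqP | std u'].
  by apply/implyP; move/forallP: (std u').
by apply/forallP => v'; apply/implyP => /eqP /std.
Qed.

Lemma std_pairC u v : std_pair u v = std_pair v u.
Proof.
by apply/std_pairP/std_pairP => std u' v' E; rewrite addmC; apply: std;
   rewrite E addmC.
Qed.

(** The difference with a smaller product of the same toric degree is a binomial of the toric ideal
    led by ['X_u * 'X_v]. *)
Lemma nonstd_initial_ideal u v :
  ~~ std_pair u v -> initial_ideal le scroll ('X_u * 'X_v).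
Proof.
rewrite negb_forall => /existsP [u']; rewrite negb_forall => /existsP [v'].
rewrite negb_imply => /andP [/eqP uv nle]; rewrite -mpolyXD.
apply: ideal_gen_mem; set m := (_ + U_(v))%MM in nle *.
set m' := (_ + _)%MM in nle.
have mm' : (m == m') = false.
  by apply/negbTE; apply: contraNneq nle => ->; apply: term_order_refl.
exists ('X_[m] - 'X_[m']), m; split=> //.
  rewrite /scroll_ideal rmorphB /= !mpolyXD !rmorphM /= !comp_mpolyXU -!tnth_nth.
  by rewrite !tnth_mktuple /scroll_image -!mpolyX_scroll_mnm -!mpolyXD uv subrr.
split=> [|m2]; rewrite mcoeff_msupp mcoeffB !mcoeffX.
  by rewrite eqxx (eq_sym m') mm' subr0 oner_eq0.
case: (eqVneq m m2) => [<- _|_]; first exact: term_order_refl.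
case: (eqVneq m' m2) => [<- _|_]; last by rewrite subrr eqxx.
by case/orP: (term_order_total ord m m') => // nle'; rewrite nle' in nle.
Qed.

Lemma delightful_lead r (u : 'I_r.+1 -> 'I_N) : (2 <= r)%N ->
  (forall s t, s != t -> ~~ std_pair (u s) (u t)) ->
  exists f, secant_ideal r scroll f /\
            leading_monomial le f (\sum_(t < r.+1) U_(u t))%MM.
Proof.
move=> r2 nstd; set m0 := (\sum_(t < _) _)%MM.
have /(dlt r2) [s [Gs sE]] :
    secant_ideal r (initial_ideal le scroll) (\prod_(t < r.+1) 'X_(u t)).
  by apply: secant_ideal_prod => t t' /nstd; apply: nonstd_initial_ideal.
have prodE : \prod_(t < r.+1) 'X_(u t) = 'X_[m0] :> {mpoly K[N]}.
  by rewrite (big_morph _ (@mpolyXD N K) (@mpolyX0 N K)).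
(* The product is a monomial in an ideal generated by leading monomials, hence a multiple of one of
   them; the same multiple of [f] has it as leading monomial. *)
have : m0 \in msupp (\sum_(c <- s) c.1 * c.2).
  by rewrite -sE prodE msuppX mem_head.
move/msupp_sum_le => /flattenP [_ /mapP [c cs ->]].
have [f [m1 [If [m1f fm1] ->]]] := Gs c ltac:(by move: cs; rewrite filter_predT).
rewrite (perm_mem (msuppMX _ _)) => /mapP [m2 _ m0E].
exists ('X_[m2] * f); split; first exact: secant_idealMl.
have suppE : msupp ('X_[m2] * f) =i [seq (m2 + m)%MM | m <- msupp f].
  by rewrite mulrC; apply: perm_mem; apply: msuppMX.
split=> [|m']; rewrite suppE m0E addmC; first exact: map_f.
by case/mapP => m /fm1 lem ->; rewrite ![(m2 + _)%MM]addmC term_orderD2r.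
Qed.

(** Otherwise a pure power of [u] would lead an element of the secant ideal for r = lam_i + 1, where
    pure powers have coefficient 0. Positivity of lam_i gives r >= 2. *)
Lemma std_pair_square u : (0 < lam (tag (enum_val u)))%N -> std_pair u u.
Proof.
move=> lam_gt0; apply/negPn/negP => nstd.
have [f [If [m0f _]]] :=
  @delightful_lead (lam (tag (enum_val u))).+1 (fun=> u) lam_gt0 (fun _ _ _ => nstd).
move: m0f; rewrite mcoeff_msupp.
have -> k : (\sum_(t < k) U_(u))%MM = (U_(u) *+ k)%MM :> 'X_{1..N}.
  by apply/mnmP => i; rewrite mnm_sumE mulmnE sum_nat_const card_ord mulnC.
by rewrite (secant_scroll_power _ If) eqxx.
Qed.

Lemma mdeg_scroll_degree m :
  (\sum_i @scroll_degree n lam m (lift ord0 i))%N = mdeg m.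
Proof.
rewrite mdegE; under eq_bigr do rewrite mnm_sumE.
rewrite exchange_big; apply: eq_bigr => k _ /=.
rewrite (bigD1 (tag (enum_val k))) //= mulmnE scroll_mnm_lift eqxx mul1n.
by rewrite big1 ?addn0 // => i ik; rewrite mulmnE scroll_mnm_lift eq_sym (negbTE ik).
Qed.

(** Each variable maps to a monomial with exactly one t, so the toric degree forces total degree
    3. *)
Lemma scroll_degree3 m (u v w : 'I_N) :
  @scroll_degree n lam m = (scroll_mnm u + scroll_mnm v + scroll_mnm w)%MM ->
  exists u' v' w', m = (U_(u') + U_(v') + U_(w'))%MM.
Proof.
move=> mE.
have m3 : mdeg m = 3.
  by rewrite -mdeg_scroll_degree mE -!scroll_degree1 -!scroll_degreeD
             mdeg_scroll_degree !mdegD !mdeg1.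
have peel d (p : 'X_{1..N}) : mdeg p = d.+1 ->
    exists k p', p = (U_(k) + p')%MM /\ mdeg p' = d.
  move=> pd; have [k pk] : exists k, p k != 0%N.
    apply/existsP; apply: contra_eqT pd => /existsPn p0.
    suff -> : p = 0%MM by rewrite mdeg0.
    by apply/mnmP => k; rewrite mnm0E; apply/eqP; rewrite -[_ == _]negbK.
  have pE : p = (U_(k) + (p - U_(k)))%MM.
    by rewrite addmC submK // lep1mP.
  exists k, (p - U_(k))%MM; split=> //.
  by move: pd; rewrite {1}pE mdegD mdeg1 => -[].
have [u' [m1 [-> m1d]]] := peel _ _ m3; have [v' [m2 [-> m2d]]] := peel _ _ m1d.
have [w' [m4 [-> /eqP]]] := peel _ _ m2d; rewrite mdeg_eq0 => /eqP ->.
by exists u', v', w'; rewrite addm0 addmA.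
Qed.

(* The [le]-minimal monomial on which [gamma] does not vanish contains no
   standard pair, so delightfulness makes it the leading monomial of some [f]
   in the secant ideal; but [gamma] annihilates that ideal. *)
Lemma std_pair_functional (gamma : 'I_N -> K) (D : 'X_{1..n.+1}) :
  (forall u v w, (scroll_mnm u + scroll_mnm v + scroll_mnm w)%MM = D ->
     std_pair v w -> gamma u + gamma v + gamma w = 0) ->
  forall u v w, (scroll_mnm u + scroll_mnm v + scroll_mnm w)%MM = D ->
     gamma u + gamma v + gamma w = 0.
Proof.
move=> std0 u0 v0 w0 D0; apply/eqP; apply/negPn/negP => g0.
pose T := ('I_N * 'I_N * 'I_N)%type.
pose P (t : T) := ((scroll_mnm t.1.1 + scroll_mnm t.1.2 + scroll_mnm t.2)%MM == D)
  && (gamma t.1.1 + gamma t.1.2 + gamma t.2 != 0).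
pose F (t : T) := (U_(t.1.1) + U_(t.1.2) + U_(t.2))%MM : 'X_{1..N}.
have P0 : P (u0, v0, w0) by rewrite /P /= D0 eqxx.
case: (extremumP F (term_order_refl ord) (term_order_trans ord)
         (term_order_total ord) P0) => -[[u v] w] /andP [/eqP /= DE g] min.
have nvw : ~~ std_pair v w by apply: contra_neqN g => /(std0 _ _ _ DE).
have nuw : ~~ std_pair u w.
  apply: contra_neqN g; move: DE; rewrite [(scroll_mnm u + _)%MM]addmC => DE.
  by rewrite [gamma u + _]addrC => /(std0 _ _ _ DE).
have nuv : ~~ std_pair u v.
  apply: contra_neqN g; move: DE; rewrite addmC addmA => DE.
  by rewrite addrC addrA => /(std0 _ _ _ DE).
pose t : 'I_3 -> 'I_N := tnth [tuple u; v; w].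
have nstd (i j : 'I_3) : i != j -> ~~ std_pair (t i) (t j).
  rewrite /t !(tnth_nth u).
  by case: i j => -[|[|[|//]]] ? [[|[|[|//]]] ?] //= _; rewrite // std_pairC.
have [f [If]] := @delightful_lead 2 t isT nstd.
have -> : (\sum_(i < 3) U_(t i))%MM = F (u, v, w).
  by rewrite !big_ord_recl big_ord0 addm0 addmA.
have [m0 m0E] : {m0 | m0 = F (u, v, w)} by exists (F (u, v, w)).
rewrite -m0E => -[m0f fm0].
pose phi (m : 'X_{1..N}) := \sum_z gamma z *+ m z.
have phiD m1 m2 : phi (m1 + m2)%MM = phi m1 + phi m2.
  by rewrite -big_split; apply: eq_bigr => z _ /=; rewrite mnmDE mulrnDr.
have phi1 z : phi U_(z)%MM = gamma z.
  rewrite /phi (bigD1 z) //= mnm1E eqxx big1 ?addr0 // => y /negbTE yz.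
  by rewrite mnm1E eq_sym yz.
have degF x : @scroll_degree n lam (F x)
    = (scroll_mnm x.1.1 + scroll_mnm x.1.2 + scroll_mnm x.2)%MM.
  by rewrite !scroll_degreeD !scroll_degree1.
have phiF x : phi (F x) = gamma x.1.1 + gamma x.1.2 + gamma x.2.
  by rewrite !phiD !phi1.
(* The coefficient relations for the single variables [z], weighted by [gamma z] and added. *)
have sum0 : \sum_(m <- msupp f | @scroll_degree n lam m == D) f@_m * phi m = 0.
  under eq_bigr do rewrite mulr_sumr.
  rewrite exchange_big big1 // => z _ /=.
  under eq_bigr do rewrite mulrnAr mulrC -mulrnAr.
  by rewrite -mulr_sumr secant2_scroll_coef ?mulr0.
move/eqP: sum0; rewrite big_mkcond (bigD1_seq m0) ?msupp_uniq //=.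
rewrite {1}m0E degF DE eqxx big1_seq => [|m /andP [mm0 mf]].
  by rewrite addr0 mulf_eq0 m0E phiF (negbTE g) orbF mcoeff_eq0 -m0E m0f.
case: eqP => // mD.
have [x1 [x2 [x3 mE]]] : exists u' v' w', m = (U_(u') + U_(v') + U_(w'))%MM.
  by apply: (@scroll_degree3 m u v w); rewrite mD.
have {}mE : m = F (x1, x2, x3) by [].
rewrite mE phiF /=; case: (eqVneq (gamma x1 + gamma x2 + gamma x3) 0) => [->|g'].
  by rewrite mulr0.
have Px : P (x1, x2, x3) by rewrite /P -degF -mE mD eqxx.
(* [m] is below [m0] because [m0] leads [f], and above it by minimality; so only [m0] contributes to
   the sum, with a nonzero term. *)
have mm : m = m0.
  by apply: (term_order_anti ord) (fm0 _ mf) _; rewrite mE m0E min.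
by rewrite mm eqxx in mm0.
Qed.

End Delightful.

(** * The combinatorics of two blocks *)

(** Recursion along [rk]: after more than [rk u] iterations the value at [u] is stable. *)
Lemma rank_fixpoint (U T : Type) (t0 : T) (rk : U -> nat)
    (Phi : (U -> T) -> U -> T) :
  (forall g g' u, (forall v, (rk v < rk u)%N -> g v = g' v) ->
     Phi g u = Phi g' u) ->
  exists g, forall u, g u = Phi g u.
Proof.
move=> local; pose it k := iter k Phi (fun=> t0).
have stable k u m : (rk u < k)%N -> (rk u < m)%N -> it k u = it m u.
  elim: k m u => // k IHk [//|m] u uk um; apply: local => v vu.
  by apply: IHk; lia.
exists (fun u => it (rk u).+1 u) => u; apply: local => v vu.
by apply: stable.
Qed.

(* Two blocks of variables x_0, ..., x_a and y_0, ..., y_b: [SX p q] says that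
   x_p x_q is standard, and [px e] is the index p for which x_p y_(e - p) is. *)
Section Staircase.
Context (K : fieldType).

(** The cubic criterion for two factors from the first block and one from the second. Testing
    [SXY q k] alone suffices, as p and q may be exchanged. *)
Definition functional_rule (a b : nat) (SX SXY : rel nat) :=
  forall (al be : nat -> K) (d : nat),
    (forall p q k, (p <= a)%N -> (q <= a)%N -> (k <= b)%N -> (p + q + k = d)%N ->
       SX p q || SXY q k -> al p + al q + be k = 0) ->
    forall p q k, (p <= a)%N -> (q <= a)%N -> (k <= b)%N -> (p + q + k = d)%N ->
      al p + al q + be k = 0.

Definition near_diagonal (a : nat) (S : rel nat) :=
  forall p q, (p <= a)%N -> (q <= a)%N -> S p q -> (p <= q.+1)%N && (q <= p.+1)%N.

(** The lattice path e -> (px e, e - px e); the second clause says that both coordinates are weakly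
    increasing. *)
Definition staircase (a b : nat) (px : nat -> nat) :=
  (forall e, (e <= a + b)%N -> [&& px e <= a, px e <= e & e <= px e + b]%N) /\
  (forall e e', (e <= e')%N -> (e' <= a + b)%N ->
     (px e <= px e')%N && (e + px e' <= e' + px e)%N).

Lemma corner_run_impossible a b (SY : rel nat) (px : nat -> nat) :
  (0 < a)%N -> (3 <= b)%N -> near_diagonal b SY ->
  functional_rule b a SY (fun k p => px (p + k)%N == p) ->
  (forall e, (e <= 3)%N -> px e = 0%N) -> False.
Proof.
move=> a0 b3 near rule px0.
(* These weights vanish on all cubics y_p y_q x_k with p + q + k = 3 that can contain a standard
   pair, but give y_0 y_2 x_1 the value 1. *)
pose al p : K := nth 0 [:: 0; 0; -1; -2] p.
pose be k : K := nth 0 [:: 1; 0; 0; -1] k.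
have := rule be al 3 _ 0%N 2%N 1%N isT (ltnW b3) a0 erefl.
rewrite /al /be /= !addr0 => H; suff /eqP : (1 : K) = 0 by rewrite oner_eq0.
apply: H.
move=> p q k pb qb ka d /orP [/(near _ _ pb qb) | /eqP].
  move=> /andP [pq qp].
  have : (k, p, q) \in [:: (0, 1, 2); (0, 2, 1); (1, 1, 1); (2, 0, 1); (2, 1, 0); (3, 0, 0)]%N.
    by rewrite !inE !xpair_eqE; lia.
  by rewrite !inE => /or4P [|||/or3P []] /eqP [-> -> ->] /=; ring.
rewrite px0; last by lia.
move=> k0; move: d; rewrite -k0 addn0 => d.
have : (p, q) \in [:: (0, 3); (1, 2); (2, 1); (3, 0)]%N.
  by rewrite !inE !xpair_eqE; lia.
by rewrite !inE => /or4P [] /eqP [-> ->] /=; ring.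
Qed.

(* Functional on the monomials x_p x_q y_k with p + q + k = 2 i + l, built
   outwards from the centre (i, l): vanishing at the standard pair of each new
   variable determines its value, and x_(i+1) x_(i-1) y_l gets the value 1. *)
Lemma inner_run_impossible a b (SX : rel nat) (px : nat -> nat) (i l : nat) :
  (0 < i < a)%N -> (0 < l < b)%N -> staircase a b px -> near_diagonal a SX ->
  functional_rule a b SX (fun q k => px (q + k)%N == q) ->
  px (i + l).-1 = i -> px (i + l)%N = i -> px (i + l).+1 = i -> False.
Proof.
move=> /andP [i0 ia] /andP [l0 lb] [pxP px_mono] near rule pxm px0 pxp.
pose D := (i + i + l)%N.
(* Twice the distance from the centre, with x placed just after y at equal distance, since the
   partner y of x_p may be equally far out. *)
pose rk (u : nat + nat) : nat :=
  match u with
  | inl p => ((p - i) + (i - p)).*2.+1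
  | inr k => ((k - l) + (l - k)).*2
  end.
pose Phi (g : nat + nat -> K) (u : nat + nat) : K :=
  match u with
  | inl p =>
    if p == i then 0 else if p == i.+1 then 1 else if p == i.-1 then 0
    else if (p <= D)%N && (D - p <= a + b)%N then
      - g (inl (px (D - p)%N)) - g (inr (D - p - px (D - p))%N)
    else 0
  | inr k =>
    if k == l then 0 else if k == l.+1 then 0 else if k == l.-1 then -1
    else if (k <= D)%N then - g (inl (D - k)./2) - g (inl (uphalf (D - k)))
    else 0
  end.
(* The path stays at x_i around the centre, so the partner of x_p has its x-index strictly closer to
   i than p, and its y-index no farther from l. *)
have pxfar p : p != i -> p != i.+1 -> p != i.-1 -> (p <= D)%N ->
    (D - p <= a + b)%N ->
    let p' := px (D - p)%N in
    (rk (inl p') < rk (inl p))%N /\ (rk (inr (D - p - p')%N) < rk (inl p))%N.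
  move=> p1 p2 p3 pD Dp /=;
  have [p' /esym p'E] : exists p', p' = px (D - p)%N by exists (px (D - p)%N).
  have := pxP _ Dp; rewrite /rk p'E => /and3P [h1 h2 h3].
  case: (leqP p i) => pi.
    have := px_mono (i + l).+1 (D - p)%N; rewrite pxp p'E; lia.
  have := px_mono (D - p)%N (i + l).-1; rewrite pxm p'E; lia.
have [g gE] : exists g, forall u, g u = Phi g u.
  apply: (rank_fixpoint 0 (rk := rk)) => g g' [p | k] gg' /=.
    case: eqP => // /eqP p1; case: eqP => // /eqP p2; case: eqP => // /eqP p3.
    case: andP => // -[pD Dp]; have [r1 r2] := pxfar p p1 p2 p3 pD Dp.
    by rewrite !gg'.
  case: eqP => // k1; case: eqP => // k2; case: eqP => // k3.
  by case: leqP => // kD; rewrite !gg' /= ?uphalf_half /D //; lia.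
pose al p := g (inl p); pose be k := g (inr k).
have al_i : al i = 0 by rewrite /al gE /= eqxx.
have al_S : al i.+1 = 1 by rewrite /al gE /= eqxx ifN //; lia.
have al_P : al i.-1 = 0 by rewrite /al gE /= eqxx !ifN //; lia.
have be_l : be l = 0 by rewrite /be gE /= eqxx.
have be_S : be l.+1 = 0 by rewrite /be gE /= eqxx ifN //; lia.
have be_P : be l.-1 = -1 by rewrite /be gE /= eqxx !ifN //; lia.
have := rule al be D _ i.+1 i.-1 l; rewrite al_S al_P be_l !addr0 => H.
suff /eqP : (1 : K) = 0 by rewrite oner_eq0.
have iD : (i.+1 + i.-1 + l = D)%N by rewrite /D; lia.
apply: H iD; try lia.
move=> p q k pa qa kb pqk /orP [/(near _ _ pa qa) /andP [pq qp] | /eqP pxq].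
  case: (eqVneq k l) => [kl|k1].
    have [-> ->] : p = i /\ q = i by move: pqk; rewrite /D; lia.
    by rewrite kl al_i be_l !addr0.
  case: (eqVneq k l.+1) => [kl|k2].
    rewrite kl be_S addr0.
    have [[-> ->]|[-> ->]] : (p = i /\ q = i.-1) \/ (p = i.-1 /\ q = i).
    - by move: pqk; rewrite /D; lia.
    - by rewrite al_i al_P addr0.
    - by rewrite al_i al_P addr0.
  case: (eqVneq k l.-1) => [kl|k3].
    rewrite kl be_P.
    have [[-> ->]|[-> ->]] : (p = i /\ q = i.+1) \/ (p = i.+1 /\ q = i).
    - by move: pqk; rewrite /D; lia.
    - by rewrite al_i al_S add0r subrr.
    - by rewrite al_i al_S addr0 subrr.
  have -> : be k = Phi g (inr k) by rewrite /be gE.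
  rewrite /= (negbTE k1) (negbTE k2) (negbTE k3).
  have -> : (k <= D)%N by rewrite -pqk; lia.
  rewrite -!/(al _).
  (* Near the diagonal the sum p + q determines the unordered pair, so the recursion for y_k covers
     every possible standard pair. *)
  have [[-> ->]|[-> ->]] : (p = (D - k)./2 /\ q = uphalf (D - k))
                        \/ (q = (D - k)./2 /\ p = uphalf (D - k)).
  - by rewrite uphalf_half -pqk; lia.
  - by ring.
  - by ring.
case: (eqVneq p i) => [pi|p1].
  have qk : (q + k = i + l)%N by move: pqk; rewrite /D; lia.
  have qi : q = i by rewrite -pxq qk.
  have kl : k = l by lia.
  by rewrite pi qi kl al_i be_l !addr0.
case: (eqVneq p i.+1) => [pi|p2].
  have qk : (q + k = (i + l).-1)%N by move: pqk; rewrite /D; lia.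
  have qi : q = i by rewrite -pxq qk.
  have kl : k = l.-1 by lia.
  by rewrite pi qi kl al_S al_i be_P addr0 subrr.
case: (eqVneq p i.-1) => [pi|p3].
  have qk : (q + k = (i + l).+1)%N by move: pqk; rewrite /D; lia.
  have qi : q = i by rewrite -pxq qk.
  have kl : k = l.+1 by lia.
  by rewrite pi qi kl al_P al_i be_S !addr0.
have -> : al p = Phi g (inl p) by rewrite /al gE.
rewrite /= (negbTE p1) (negbTE p2) (negbTE p3).
have -> : (p <= D)%N by rewrite -pqk; lia.
have DpE : (D - p = q + k)%N by rewrite -pqk; lia.
rewrite DpE leq_add //= pxq addKn -/(al _) -/(be _).
by ring.
Qed.

(** Reversing both blocks moves the end (a, b) of the path to the origin, so that the corner
    argument applies there too. *)
Lemma functional_rule_mirror a b (SX : rel nat) (px : nat -> nat) :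
  staircase a b px ->
  functional_rule b a SX (fun k p => px (p + k)%N == p) ->
  functional_rule b a (fun k l => SX (b - k)%N (b - l)%N)
    (fun k p => (a - px (a + b - (p + k)))%N == p).
Proof.
move=> [pxP _] rule be al d std0 p q k pb qb ka d0.
have := rule (fun k => be (b - k)%N) (fun p => al (a - p)%N) (b + b + a - d)%N.
move=> /(_ _ (b - p)%N (b - q)%N (a - k)%N); rewrite !subKn //; apply; try lia.
move=> p' q' k' pb' qb' ka' d' std; apply: std0; try lia.
rewrite !subKn //; case/orP: std => [-> // | /eqP pxk]; apply/orP; right.
have -> : (a + b - (a - k' + (b - q')) = k' + q')%N by lia.
by rewrite pxk.
Qed.

Lemma staircase_bound a b (SX SY : rel nat) (px : nat -> nat) :
  (0 < a)%N -> staircase a b px -> near_diagonal a SX -> near_diagonal b SY ->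
  functional_rule a b SX (fun q k => px (q + k)%N == q) ->
  functional_rule b a SY (fun k p => px (p + k)%N == p) ->
  (b <= a + 3)%N.
Proof.
move=> a0 st nearX nearY ruleX ruleY; rewrite leqNgt; apply/negP => ab.
have [pxP px_mono] := st.
have left_end : (0 < px 3)%N.
  rewrite lt0n; apply/negP => /eqP px3.
  apply: (corner_run_impossible a0 _ nearY ruleY) => [|e e3]; first by lia.
  have := px_mono e 3%N e3; lia.
have right_end : (px (a + b - 3) < a)%N.
  rewrite ltnNge; apply/negP => px3.
  have mirror := functional_rule_mirror st ruleY.
  apply: (corner_run_impossible (px := fun e => (a - px (a + b - e))%N)
            a0 _ _ mirror) => [|k l kb lb s|e e3] /=.
  - by lia.
  - by have := nearY _ _ (leq_subr k b) (leq_subr l b) s; lia.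
  - have /andP [] := px_mono (a + b - 3)%N (a + b - e)%N ltac:(lia) ltac:(lia).
    have /and3P [] := pxP (a + b - e)%N ltac:(lia).
    by lia.
have run e : (0 < e)%N -> (e < a + b)%N -> px e.-1 = px e -> px e.+1 = px e ->
    (0 < px e < a)%N -> False.
  move=> e0 eab pxm pxp pxi.
  (* These bounds yield 0 < e - px e < b. *)
  have pxe1 := pxP e.-1 ltac:(lia); have pxe2 := pxP e.+1 eab.
  have eE : (px e + (e - px e) = e)%N by lia.
  apply: (inner_run_impossible (i := px e) (l := (e - px e)%N) pxi _ st nearX ruleX);
    rewrite ?eE //; lia.
(* Away from the ends every two steps raise the x-index by at least one. *)
have climb j : (j < a)%N -> (j < px (3 + j.*2))%N.
  elim: j => // j IHj ja; have := IHj (ltnW ja); rewrite doubleS.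
  have := px_mono (3 + j.*2)%N (3 + j.*2).+1 ltac:(lia) ltac:(lia).
  have := px_mono (3 + j.*2).+1 (3 + j.*2).+2 ltac:(lia) ltac:(lia).
  have := run (3 + j.*2).+1 ltac:(lia) ltac:(lia).
  by rewrite /= !addnS; lia.
(* The path has reached x_a by step 2a + 1, which is at most a + b - 3 once b >= a + 4; this
   contradicts [right_end]. *)
have := climb a.-1; have := px_mono (3 + a.-1.*2)%N (a + b - 3)%N; lia.
Qed.
End Staircase.

(** * Two blocks of the scroll *)

(** Induction on k: add the convexity inequality at p + k and cancel the common terms. *)
Lemma term_order_convex_chain (N : nat) (le : rel 'X_{1..N}) (d : nat -> 'X_{1..N})
    (L : nat) :
  term_order le ->
  (forall p, (p.+2 <= L)%N -> le (d p.+1 + d p.+1)%MM (d p + d p.+2)%MM) ->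
  forall p k, (p + k < L)%N ->
    le (d p.+1 + d (p + k)%N)%MM (d p + d (p + k).+1)%MM.
Proof.
move=> ord conv p; elim=> [_|k IHk pk].
  by rewrite addn0 addmC; apply: term_order_refl ord _.
rewrite addnS in pk *; rewrite -(term_orderD2r ord (d (p + k)%N + d (p + k).+1)%MM).
have := term_orderD ord (IHk (ltnW pk)) (conv _ pk).
by congr (le _ _); apply/mnmP => j; rewrite !mnmDE; lia.
Qed.

(** * Variables addressed by block and position *)

Section Points.
Context (n : nat) (lam : 'I_n -> nat).
Local Notation N := (scroll_dim lam).

(** [inord] sends positions beyond [lam i] to 0, hence the bounds in the lemmas below. *)
Definition scroll_point (i : 'I_n) (p : nat) : 'I_N :=
  enum_rank (Tagged (fun i => 'I_(lam i).+1) (inord p : 'I_(lam i).+1)).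

Lemma scroll_pointP (u : 'I_N) :
  exists i p, (p <= lam i)%N /\ u = scroll_point i p.
Proof.
exists (tag (enum_val u)), (tagged (enum_val u)); rewrite -ltnS ltn_ord; split=> //.
rewrite /scroll_point inord_val.
rewrite -[LHS]enum_valK; congr enum_rank; by case: (enum_val u).
Qed.

Lemma scroll_point_lift i p j :
  scroll_mnm (scroll_point i p) (lift ord0 j) = (i == j).
Proof. by rewrite scroll_mnm_lift enum_rankK. Qed.

Lemma scroll_point0 i p :
  (p <= lam i)%N -> scroll_mnm (scroll_point i p) ord0 = p.
Proof. by move=> pi; rewrite scroll_mnm0 enum_rankK /= inordK. Qed.

Lemma scroll_pointE i p : (p <= lam i)%N ->
  scroll_mnm (scroll_point i p) = (U_(ord0) *+ p + U_(lift ord0 i))%MM.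
Proof. by move=> pi; rewrite /scroll_mnm enum_rankK /= inordK. Qed.

Lemma scroll_point_inj i j p q : (p <= lam i)%N -> (q <= lam j)%N ->
  scroll_point i p = scroll_point j q -> i = j /\ p = q.
Proof.
move=> pi qj e; split; last by rewrite -(scroll_point0 pi) e scroll_point0.
have := scroll_point_lift i p i; rewrite e scroll_point_lift eqxx.
by case: eqP.
Qed.

Lemma scroll_point_neq i j p q : (p <= lam i)%N -> (q <= lam j)%N ->
  (i != j) || (p != q) -> (scroll_point i p == scroll_point j q) = false.
Proof.
move=> pi qj; apply: contraTF => /eqP /(scroll_point_inj pi qj) [-> ->].
by rewrite !eqxx.
Qed.

Lemma lift0_eq (i j : 'I_n) : (lift ord0 i == lift ord0 j) = (i == j).
Proof. exact: inj_eq (@lift_inj _ ord0) _ _. Qed.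

Lemma scroll_pair_form (i j : 'I_n) (e : nat) (u v : 'I_N) : i != j ->
  (scroll_mnm u + scroll_mnm v)%MM
    = (U_(ord0) *+ e + U_(lift ord0 i) + U_(lift ord0 j))%MM ->
  exists p q, [/\ (p <= lam i)%N, (q <= lam j)%N, (p + q)%N = e &
    (u = scroll_point i p /\ v = scroll_point j q) \/
    (u = scroll_point j q /\ v = scroll_point i p)].
Proof.
move=> ij /mnmP E.
have [iu [p [pu uE]]] := scroll_pointP u; have [iv [q [qv vE]]] := scroll_pointP v.
have scroll_mnmD k : (scroll_mnm u + scroll_mnm v)%MM k
    = (scroll_mnm u k + scroll_mnm v k)%N by rewrite (mnmDE k (scroll_mnm u)).
have := E (lift ord0 i); have := E (lift ord0 j); have := E ord0.
rewrite !scroll_mnmD {scroll_mnmD} uE vE !scroll_point_lift !scroll_point0 //.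
rewrite !mnmDE !mulmnE !mnm1E !lift0_eq !eqxx /=.
rewrite (eq_sym j) (negbTE ij) mul1n mul0n !addn0 !add0n => pqe.
case: (eqVneq iu i) => [ui|_]; case: (eqVneq iv i) => [vi|_] //=; subst => + _.
- rewrite (negbTE ij) add0n; case: eqP => //= vj _; subst.
  by exists p, q; split=> //; left.
- rewrite (negbTE ij) addn0; case: eqP => //= uj _; subst.
  by exists q, p; split=> //; [rewrite addnC | right].
Qed.

Lemma scroll_triple_form (i j : 'I_n) (d : nat) (u v w : 'I_N) : i != j ->
  (scroll_mnm u + scroll_mnm v + scroll_mnm w)%MM
    = (U_(ord0) *+ d + U_(lift ord0 i) *+ 2 + U_(lift ord0 j))%MM ->
  exists p q k, [/\ (p <= lam i)%N, (q <= lam i)%N, (k <= lam j)%N,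
      (p + q + k)%N = d &
    [\/ [/\ u = scroll_point j k, v = scroll_point i p & w = scroll_point i q],
        [/\ u = scroll_point i p, v = scroll_point j k & w = scroll_point i q]
      | [/\ u = scroll_point i p, v = scroll_point i q & w = scroll_point j k]]].
Proof.
move=> ij /mnmP E.
have [iu [p [pu uE]]] := scroll_pointP u; have [iv [q [qv vE]]] := scroll_pointP v.
have [iw [r [rw wE]]] := scroll_pointP w.
have scroll_mnmD k : (scroll_mnm u + scroll_mnm v + scroll_mnm w)%MM k
    = (scroll_mnm u k + scroll_mnm v k + scroll_mnm w k)%N.
  by rewrite (mnmDE k (scroll_mnm u + scroll_mnm v)) (mnmDE k (scroll_mnm u)).
have := E (lift ord0 i); have := E (lift ord0 j); have := E ord0.
rewrite !scroll_mnmD {scroll_mnmD} uE vE wE !scroll_point_lift !scroll_point0 //.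
rewrite !mnmDE !mulmnE !mnm1E !lift0_eq !eqxx /=.
rewrite (eq_sym j) (negbTE ij) !(mul1n, mul0n, addn0, add0n) => pqr.
case: (eqVneq iu i) => [ui|_]; case: (eqVneq iv i) => [vi|_];
  case: (eqVneq iw i) => [wi|_] //=; subst => + _;
  rewrite (negbTE ij) ?addn0 ?add0n; case: eqP => //= ej _; subst.
- by exists p, q, r; split=> //; apply: Or33.
- by exists p, r, q; split=> //; [lia | apply: Or32].
- by exists q, r, p; split=> //; [lia | apply: Or31].
Qed.

End Points.

(** * Standard pairs inside a block and between two blocks *)

Section TwoBlocks.
Context (K : fieldType) (n : nat) (lam : 'I_n -> nat).
Local Notation N := (scroll_dim lam).
Local Notation scroll := (@scroll_ideal K n lam).
Local Notation pt := (@scroll_point n lam).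
Context (lam_gt0 : forall i, (0 < lam i)%N).
Context (le : rel 'X_{1..N}) (ord : term_order le) (dlt : delightful scroll le).
Lemma scroll_point_convex k p q : (p + q < lam k)%N ->
  le (U_(pt k p.+1) + U_(pt k (p + q)%N))%MM
     (U_(pt k p) + U_(pt k (p + q).+1))%MM.
Proof.
apply: (@term_order_convex_chain _ _ (fun p => U_(pt k p)%MM) (lam k) ord) => {p q} p pk.
have /std_pairP := std_pair_square ord dlt (lam_gt0 (tag (enum_val (pt k p.+1)))).
apply; rewrite !scroll_pointE; try lia.
by apply/mnmP => l; rewrite !mnmDE !mulmnE; lia.
Qed.

(** By convexity, moving two indices at distance at least 2 towards each other does not raise the
    product; a standard pair would then equal the moved one. *)
Lemma std_near_diagonal k :
  near_diagonal (lam k) (fun p q => std_pair le (pt k p) (pt k q)).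
Proof.
have near p q : (p <= lam k)%N -> (q <= lam k)%N ->
    std_pair le (pt k p) (pt k q) -> (q <= p.+1)%N.
  move=> pk qk /std_pairP std; rewrite leqNgt; apply/negP => pq.
  have conv := @scroll_point_convex k p (q.-1 - p) ltac:(lia).
  have qE : (p + (q.-1 - p) = q.-1)%N by lia.
  rewrite qE prednK in conv; last by lia.
  have /std std' : (scroll_mnm (pt k p.+1) + scroll_mnm (pt k q.-1)
                    = scroll_mnm (pt k p) + scroll_mnm (pt k q))%MM.
    rewrite !scroll_pointE; try lia.
    by apply/mnmP => l; rewrite !mnmDE !mulmnE; nia.
  have /mnmP /(_ (pt k p)) := term_order_anti ord std' conv.
  by rewrite !mnmDE !mnm1E eqxx !scroll_point_neq //; lia.
move=> p q pk qk std; apply/andP; split; last exact: near.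
by apply: near; rewrite // std_pairC.
Qed.

Context (i j : 'I_n) (ij : i != j).

Lemma std_rule :
  functional_rule K (lam i) (lam j) (fun p q => std_pair le (pt i p) (pt i q))
    (fun q k => std_pair le (pt i q) (pt j k)).
Proof.
move=> al be d std0 p q k pi qi kj pqk.
(* Blocks other than i also receive [be]; only i and j occur in the degree considered. *)
pose gamma (u : 'I_N) : K :=
  let s : scroll_index lam := enum_val u in
  if tag s == i then al (tagged s) else be (tagged s).
have gi p' : (p' <= lam i)%N -> gamma (pt i p') = al p'.
  by move=> p'i; rewrite /gamma enum_rankK /= eqxx inordK.
have gj k' : (k' <= lam j)%N -> gamma (pt j k') = be k'.
  by move=> k'j; rewrite /gamma enum_rankK /= eq_sym (negbTE ij) inordK.
have := std_pair_functional ord dlt (gamma := gamma)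
  (D := (U_(ord0) *+ d + U_(lift ord0 i) *+ 2 + U_(lift ord0 j))%MM) _
  (u := pt i p) (v := pt i q) (w := pt j k).
rewrite !gi ?gj //; apply.
  move=> u v w /(scroll_triple_form ij).
  move=> [p' [q' [k' [p'i q'i k'j d' uvw]]]] std.
  have := std0 p' q' k' p'i q'i k'j d'.
  case: uvw std => -[-> -> ->] std; rewrite !gi ?gj //.
  - by rewrite std addrC addrA; apply.
  - by rewrite (std_pairC _ (pt i q')) std orbT addrAC; apply.
  - by rewrite std orbT; apply.
rewrite !scroll_pointE //.
by apply/mnmP => l; rewrite !mnmDE !mulmnE; nia.
Qed.

Lemma std_exists e : (e <= lam i + lam j)%N ->
  exists p l, [/\ (p <= lam i)%N, (l <= lam j)%N, (p + l)%N = e &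
    std_pair le (pt i p) (pt j l)].
Proof.
move=> eij; pose E := (U_(ord0) *+ e + U_(lift ord0 i) + U_(lift ord0 j))%MM
  : 'X_{1..n.+1}.
pose P (t : 'I_N * 'I_N) := (scroll_mnm t.1 + scroll_mnm t.2)%MM == E.
pose F (t : 'I_N * 'I_N) := (U_(t.1) + U_(t.2))%MM : 'X_{1..N}.
have P0 : P (pt i (minn e (lam i)), pt j (e - minn e (lam i))%N).
  rewrite /P /= !scroll_pointE; try lia.
  by apply/eqP/mnmP => l; rewrite /E !mnmDE !mulmnE; nia.
case: (extremumP F (term_order_refl ord) (term_order_trans ord)
         (term_order_total ord) P0) => -[u v] /eqP /= uvE min.
have std : std_pair le u v.
  apply/std_pairP => u' v' uv'; apply: (min (u', v')).
  by rewrite /P /= uv' uvE.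
have [p [l [pi lj pl [[uE vE]|[uE vE]]]]] := scroll_pair_form ij uvE.
  by exists p, l; split=> //; rewrite -uE -vE.
by exists p, l; split=> //; rewrite -uE -vE std_pairC.
Qed.

(** An exchange argument: standardness bounds each pair by its neighbour one step towards the other,
    while convexity in both blocks bounds the product of the neighbours by that of the pairs.
    Equality follows, which is absurd. *)
Lemma std_monotone p l p' l' :
  (p <= lam i)%N -> (l <= lam j)%N -> (p' <= lam i)%N -> (l' <= lam j)%N ->
  std_pair le (pt i p) (pt j l) -> std_pair le (pt i p') (pt j l') ->
  (p' < p)%N -> (l < l')%N -> False.
Proof.
move=> pi lj p'i l'j /std_pairP std /std_pairP std' pp ll.
have /std A : (scroll_mnm (pt i p.-1) + scroll_mnm (pt j l.+1)
               = scroll_mnm (pt i p) + scroll_mnm (pt j l))%MM.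
  rewrite !scroll_pointE; try lia.
  by apply/mnmP => k; rewrite !mnmDE !mulmnE; nia.
have /std' B : (scroll_mnm (pt i p'.+1) + scroll_mnm (pt j l'.-1)
               = scroll_mnm (pt i p') + scroll_mnm (pt j l'))%MM.
  rewrite !scroll_pointE; try lia.
  by apply/mnmP => k; rewrite !mnmDE !mulmnE; nia.
have C := @scroll_point_convex i p' (p.-1 - p') ltac:(lia).
have pE : (p' + (p.-1 - p') = p.-1)%N by lia.
rewrite pE prednK in C; last by lia.
have D := @scroll_point_convex j l (l'.-1 - l) ltac:(lia).
have lE : (l + (l'.-1 - l) = l'.-1)%N by lia.
rewrite lE prednK in D; last by lia.
have back : le ((U_(pt i p.-1) + U_(pt j l.+1)) + (U_(pt i p'.+1) + U_(pt j l'.-1)))%MM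
               ((U_(pt i p) + U_(pt j l)) + (U_(pt i p') + U_(pt j l')))%MM.
  by have := term_orderD ord C D; congr (le _ _); apply/mnmP => k; rewrite !mnmDE; lia.
have /mnmP /(_ (pt i p)) := term_orderD_eq ord A B back.
by rewrite !mnmDE !mnm1E eqxx !scroll_point_neq // 1?eq_sym ?ij //; lia.
Qed.

(** Distinct standard pairs of the same degree would cross, as would pairs violating monotonicity;
    [std_monotone] excludes both. *)
Lemma std_staircase : exists px, staircase (lam i) (lam j) px /\
  forall p l, (p <= lam i)%N -> (l <= lam j)%N ->
    std_pair le (pt i p) (pt j l) -> px (p + l)%N = p.
Proof.
have ex (e : 'I_(lam i + lam j).+1) : exists p,
    [/\ (p <= lam i)%N, (p <= e)%N, (e <= p + lam j)%N &
     std_pair le (pt i p) (pt j (e - p)%N)].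
  have [|p [l [pi lj ple std]]] := @std_exists e; first by rewrite -ltnS.
  by exists p; split; rewrite -?ple ?addKn //; lia.
have [f fP] := fin_all_exists ex; pose px e := f (inord e).
have {fP} pxP e : (e <= lam i + lam j)%N ->
    [/\ (px e <= lam i)%N, (px e <= e)%N, (e <= px e + lam j)%N &
     std_pair le (pt i (px e)) (pt j (e - px e)%N)].
  by move=> eij; have := fP (inord e); rewrite inordK.
exists px; split; [split=> [e eij | e e' ee' e'ij] | move=> p l pi lj std].
- by have [-> -> ->] := pxP e eij.
- have [h1 h2 h3 h4] := pxP e ltac:(lia); have [g1 g2 g3 g4] := pxP e' e'ij.
  apply/andP; split; rewrite leqNgt; apply/negP => lt.
    by apply: (std_monotone _ _ _ _ h4 g4); lia.
  by apply: (std_monotone _ _ _ _ g4 h4); lia.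
- have [h1 h2 h3 h4] := pxP (p + l)%N ltac:(lia).
  apply/eqP; rewrite eqn_leq; apply/andP; split; rewrite leqNgt; apply/negP => lt.
    by apply: (std_monotone _ _ _ _ h4 std); lia.
  by apply: (std_monotone _ _ _ _ std h4); lia.
Qed.

End TwoBlocks.

Theorem proposition5p8 (K : fieldType) (n : nat) (lam : 'I_n -> nat)
    (lam_gt0 : forall i : 'I_n, (0 < lam i)%N)
    (has_delightful : exists le : rel 'X_{1..scroll_dim lam},
        term_order le /\ delightful (@scroll_ideal K n lam) le) :
  exists m : int, forall i : 'I_n,
    Posz (lam i) \in [:: m; m + 1; m + 2; m + 3]%R.
Proof.
have [le [ord dlt]] := has_delightful.
have bound i j : (lam j <= lam i + 3)%N.
  case: (eqVneq i j) => [->|ij]; first by rewrite leq_addr.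
  have [px [st std_px]] := std_staircase lam_gt0 ord dlt ij.
  have nearX := @std_near_diagonal K n lam lam_gt0 le ord dlt i.
  have nearY := @std_near_diagonal K n lam lam_gt0 le ord dlt j.
  apply: (@staircase_bound K _ _ _ _ px (lam_gt0 i) st nearX nearY) => al be d std0.
    apply: (std_rule ord dlt ij) => p q k pi qi kj pqk std.
    apply: std0 => //; case/orP: std => [-> // | std].
    by rewrite (std_px q k) // eqxx orbT.
  (* The second rule has the blocks exchanged, while [px] still indexes block i. *)
  rewrite eq_sym in ij.
  apply: (std_rule ord dlt ij) => p q k pj qj ki pqk std.
  apply: std0 => //; case/orP: std => [-> // | std].
  by rewrite addnC in pqk *; rewrite (std_px k q) ?eqxx ?orbT // std_pairC.
case: n lam lam_gt0 has_delightful le ord dlt bound => [|n] lam _ _ _ _ _ bound.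
  by exists 0 => -[].
(* The least block length serves as m. *)
case: (arg_minnP lam (P := predT) (i0 := ord0) isT) => i0 _ min.
exists (Posz (lam i0)) => i; have := bound i0 i; have := min i isT.
by rewrite !inE; lia.
Qed.
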